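(* Let $M$ and $N$ be finitely generated monoids, each having only finitely many left ideals and finitely many right ideals, and suppose $M$ and $N$ are quasi-isometric. If $M$ is finitely presented, then $N$ is finitely presented.
   Context: For a semigroup $S$ generated by a finite set $A$, define $d_A(x,y)=\inf\{|w|: w\in A^*,\ xw=y\}$, where $A^*$ is the free monoid on $A$ (the empty word allowed) and $\inf\emptyset=\infty$; $(S,d_A)$ is a semimetric space (a set with a function to $\mathbb{R}^{\ge0}\cup\{\infty\}$ vanishing exactly on the diagonal and satisfying the triangle inequality, not necessarily symmetric). A map $f:X\to X'$ between semimetric spaces is a quasi-isometry if there exist constants $1\le\lambda<\infty$, $0<\epsilon<\infty$, $0\le\mu<\infty$ such that $\frac1\lambda d(x,y)-\epsilon\le d'(f(x),f(y))\le\lambda d(x,y)+\epsilon$ for all $x,y\in X$, and for every $x'\in X'$ there is $x\in X$ with $\max(d'(x',f(x)),d'(f(x),x'))\le\mu$. Finitely generated semigroups (or monoids) $S,T$ are quasi-isometric if $(S,d_A)$ and $(T,d_B)$ are quasi-isometric for some finite generating sets $A$ of $S$ and $B$ of $T$ (this does not depend on the choice of finite generating sets). *)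

(* Defs.v *)
From HB Require Import structures.
From mathcomp Require Import all_boot all_order all_algebra.
From mathcomp Require Import classical_sets boolp reals constructive_ereal ereal.
From mathcomp Require Import Rstruct.

Set Implicit Arguments. Unset Strict Implicit. Unset Printing Implicit Defensive.
Import Order.TTheory GRing.Theory Num.Theory.
Local Open Scope ring_scope.
Notation R := Rdefinitions.R.

Record monoid := Monoid {
  mcarrier :> Type;
  mmul : mcarrier -> mcarrier -> mcarrier;
  mone : mcarrier;
  mmulA : forall x y z, mmul x (mmul y z) = mmul (mmul x y) z;
  mmul1l : forall x, mmul mone x = x;
  mmul1r : forall x, mmul x mone = x }.

Definition weval (M : monoid) (n : nat) (g : 'I_n -> M) (w : seq 'I_n) : M :=
  foldr (fun a m => mmul (g a) m) (mone M) w.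

Definition generates (M : monoid) (n : nat) (g : 'I_n -> M) : Prop :=
  forall x : M, exists w : seq 'I_n, weval g w = x.

Definition fin_gen (M : monoid) : Prop :=
  exists n (g : 'I_n -> M), generates g.

(* d_A(x,y) = inf { |w| : w in A^*, x w = y } in [0, +oo], inf of empty = +oo. *)
Definition dA (M : monoid) (n : nat) (g : 'I_n -> M) (x y : M) : \bar R :=
  ereal_inf [set ((size w)%:R : R)%:E | w in [set w : seq 'I_n | mmul x (weval g w) = y]].

Definition quasi_isometry (X X' : Type) (d : X -> X -> \bar R) (d' : X' -> X' -> \bar R)
  (f : X -> X') : Prop :=
  exists (lam eps mu : R),
    [/\ 1 <= lam, 0 < eps, 0 <= mu,
        (forall x y : X,
           ((lam^-1)%:E * d x y - eps%:E <= d' (f x) (f y))%E /\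
           (d' (f x) (f y) <= lam%:E * d x y + eps%:E)%E)
      & (forall x' : X', exists x : X,
           (d' x' (f x) <= mu%:E)%E /\ (d' (f x) x' <= mu%:E)%E)].

Definition quasi_isometric (M N : monoid) : Prop :=
  exists (n : nat) (g : 'I_n -> M) (m : nat) (h : 'I_m -> N),
    generates g /\ generates h /\
    exists f : M -> N, quasi_isometry (dA g) (dA h) f.

Definition left_ideal (M : monoid) (I : M -> Prop) : Prop :=
  (exists x, I x) /\ forall s x : M, I x -> I (mmul s x).
Definition right_ideal (M : monoid) (I : M -> Prop) : Prop :=
  (exists x, I x) /\ forall s x : M, I x -> I (mmul x s).

Definition finitely_many (M : Type) (P : (M -> Prop) -> Prop) : Prop :=
  exists L : seq (M -> Prop),
    forall I, P I -> exists2 J, List.In J L & forall x, I x <-> J x.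

Inductive thue_cong (n : nat) (R : seq (seq 'I_n * seq 'I_n)) :
  seq 'I_n -> seq 'I_n -> Prop :=
| tc_step : forall p q l r, List.In (l, r) R -> thue_cong R (p ++ l ++ q) (p ++ r ++ q)
| tc_refl : forall u, thue_cong R u u
| tc_sym : forall u v, thue_cong R u v -> thue_cong R v u
| tc_trans : forall u v w, thue_cong R u v -> thue_cong R v w -> thue_cong R u w.

(* M is finitely presented: M is isomorphic to A^*/R for finite A and finite R,
   i.e. the evaluation A^* -> M is surjective with kernel the congruence of R. *)
Definition fin_pres (M : monoid) : Prop :=
  exists (n : nat) (g : 'I_n -> M) (R : seq (seq 'I_n * seq 'I_n)),
    generates g /\ forall u v, weval g u = weval g v <-> thue_cong R u v.

(* Main.v *)
From mathcomp Require Import all_boot all_order all_algebra.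
From mathcomp Require Import classical_sets boolp reals constructive_ereal ereal.
From mathcomp Require Import Rstruct.
Require Import Defs.

Set Implicit Arguments. Unset Strict Implicit. Unset Printing Implicit Defensive.

(** Read words over the generators as paths in the right Cayley graph, and call
    two paths with the same origin [K]-homotopic when they are linked by
    replacements of subpaths of length at most [K] by subpaths of length at most
    [K] with the same end points.  That all parallel paths issued from [1] are
    [K]-homotopic for some [K] follows from finite presentability, and a ladder
    argument shows that it is invariant under quasi-isometry.

    Conversely, replacing [l] by [r] after a prefix [p] only requires
    [p l = p r], not [l = r]; but this condition depends only on the L-class of
    [p].  When there are finitely many left ideals, finitely many relations
    suffice to rewrite any [p] as [s w] with [w] of bounded length in the
    L-class of [p], and then [w l = w r] is a relation of bounded length. *)

(** * Words as paths in the Cayley graph, and bounded homotopies between them *)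

Section Words.
Variables (M : monoid) (n : nat) (g : 'I_n -> M).
Implicit Types (x y : M) (u v w p q l r : seq 'I_n) (K : nat).

Lemma weval_cat u v : weval g (u ++ v) = mmul (weval g u) (weval g v).
Proof. by elim: u => [|a u IH] /=; rewrite ?mmul1l // IH mmulA. Qed.

Lemma weval1 a : weval g [:: a] = g a.
Proof. exact: mmul1r. Qed.

Definition reach K x y := exists2 w, size w <= K & mmul x (weval g w) = y.

Lemma reach_trans K K' x y z : reach K x y -> reach K' y z -> reach (K + K') x z.
Proof.
move=> [u su <-] [v sv <-]; exists (u ++ v); first by rewrite size_cat leq_add.
by rewrite weval_cat mmulA.
Qed.

Inductive homot x K : seq 'I_n -> seq 'I_n -> Prop :=
| homot_step p l r q : size l <= K -> size r <= K ->
    mmul x (weval g (p ++ l)) = mmul x (weval g (p ++ r)) ->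
    homot x K (p ++ l ++ q) (p ++ r ++ q)
| homot_refl u : homot x K u u
| homot_sym u v : homot x K u v -> homot x K v u
| homot_trans u v w : homot x K u v -> homot x K v w -> homot x K u w.

Lemma homotW x K K' u v : K <= K' -> homot x K u v -> homot x K' u v.
Proof.
move=> le_K; elim=> {u v} [p l r q sl sr e|u|u v _|u v w _ + _].
- by apply: homot_step e; apply: leq_trans le_K.
- exact: homot_refl.
- exact: homot_sym.
- exact: homot_trans.
Qed.

Lemma homot_catr x K u v q : homot x K u v -> homot x K (u ++ q) (v ++ q).
Proof.
elim=> {u v} [p l r q' sl sr e|u|u v _|u v w _ + _].
- by rewrite -!catA; apply: homot_step.
- exact: homot_refl.
- exact: homot_sym.
- exact: homot_trans.
Qed.

Lemma homot_catl x K p u v :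
  homot (mmul x (weval g p)) K u v -> homot x K (p ++ u) (p ++ v).
Proof.
elim=> {u v} [p' l r q sl sr|u|u v _|u v w _ + _].
- rewrite -!mmulA -!weval_cat => e.
  by rewrite !(catA p); apply: homot_step; rewrite // -!catA.
- exact: homot_refl.
- exact: homot_sym.
- exact: homot_trans.
Qed.

Lemma homot_parallel x K l r : size l <= K -> size r <= K ->
  mmul x (weval g l) = mmul x (weval g r) -> homot x K l r.
Proof.
by move=> sl sr e; have := @homot_step x K [::] l r [::] sl sr e; rewrite !cats0.
Qed.

Definition coarsely_simply_connected :=
  exists K, forall u v, weval g u = weval g v -> homot (mone M) K u v.

Lemma uniform_bound_words C (P : seq 'I_n -> nat -> Prop) :
  (forall w k k', k <= k' -> P w k -> P w k') ->
  (forall w, exists k, P w k) -> exists k, forall w, size w <= C -> P w k.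
Proof.
move=> PW exP.
have [b Pb] := choice exP.
exists (\max_(i < C.+1) \max_(t : i.-tuple 'I_n) b t) => w sw.
apply: PW (Pb w); apply: leq_trans (leq_bigmax (Ordinal (sw : size w < C.+1))).
exact: (leq_bigmax (in_tuple w)).
Qed.

Lemma In_mem (T : eqType) (x : T) (s : seq T) : List.In x s <-> x \in s.
Proof.
elim: s => [//|y s IH] /=; rewrite in_cons; split.
- by case=> [->|/IH ->]; rewrite ?eqxx ?orbT.
- by case/orP=> [/eqP ->|/IH]; [left|right].
Qed.

(** Both directions serve later: one makes the presentation sound, the other makes every short valid
    relation available. *)
Lemma short_relations_finite K : exists S : seq (seq 'I_n * seq 'I_n),
  forall l r, List.In (l, r) S <->
    [/\ size l <= K, size r <= K & weval g l = weval g r].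
Proof.
pose W := flatten [seq [seq val t | t : k.-tuple 'I_n] | k <- iota 0 K.+1].
have inW w : (w \in W) = (size w <= K).
  apply/flattenP/idP => [[s /mapP[k]]|sw].
    by rewrite mem_iota => lt_k -> /fintype.imageP[t _ ->]; rewrite size_tuple.
  exists [seq val t | t : (size w).-tuple 'I_n].
    by apply/mapP; exists (size w); rewrite // mem_iota.
  by apply/fintype.imageP; exists (in_tuple w).
exists [seq e <- [seq (l, r) | l <- W, r <- W] | `[< weval g e.1 = weval g e.2 >]].
move=> l r; rewrite In_mem mem_filter /=; split.
- case/andP=> /asboolP e /allpairsP[[l' r'] /= [+ + [el er]]].
  by rewrite -el -er !inW.
- by case=> sl sr e; apply/andP; split; [apply/asboolP|rewrite allpairs_f // inW].
Qed.

(** Each relation holds in [M], so its two sides stay parallel after any prefix; [K] is the length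
    of the longest side occurring in [S]. *)
Lemma thue_cong_homot (S : seq (seq 'I_n * seq 'I_n)) :
  (forall u v, thue_cong S u v -> weval g u = weval g v) ->
  exists K, forall u v, thue_cong S u v -> homot (mone M) K u v.
Proof.
move=> sound; pose K := \max_(e <- S) maxn (size e.1) (size e.2).
have leK l r : List.In (l, r) S -> (size l <= K) && (size r <= K).
  by move/In_mem=> lrS; rewrite -geq_max; apply: (leq_bigmax_seq (l, r)).
exists K => u v; elim=> {u v} [p q l r lrS|u|u v _|u v w _ + _].
- have /andP[sl sr] := leK _ _ lrS; apply: homot_step => //; congr mmul.
  by apply: sound; have := tc_step p [::] lrS; rewrite !cats0.
- exact: homot_refl.
- exact: homot_sym.
- exact: homot_trans.
Qed.

Lemma thue_cong_cat (S : seq (seq 'I_n * seq 'I_n)) p q u v :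
  thue_cong S u v -> thue_cong S (p ++ u ++ q) (p ++ v ++ q).
Proof.
elim=> {u v} [p' q' l r lrS|u|u v _|u v w _ + _].
- by rewrite -!catA !(catA p); apply: tc_step.
- exact: tc_refl.
- exact: tc_sym.
- exact: tc_trans.
Qed.

(** * Green's L-classes and rewriting to short representatives *)

Definition left_equiv x y :=
  (exists s, x = mmul s y) /\ (exists t, y = mmul t x).

(** L-equivalence means generating the same principal left ideal, so one word for each principal
    ideal in the finite list suffices. *)
Lemma left_classes_bounded : generates g -> finitely_many (@left_ideal M) ->
  exists C, forall x, exists2 w, size w <= C & left_equiv x (weval g w).
Proof.
move=> gen [L finL].
suff [C HC] : exists C, forall x J, List.In J L ->
    (forall z, (exists s, z = mmul s x) <-> J z) ->
    exists2 w, size w <= C & left_equiv x (weval g w).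
  exists C => x; pose I z := exists s, z = mmul s x.
  have [|J JL IJ] := finL I; last exact: HC JL IJ.
  split; first by exists x, (mone M); rewrite mmul1l.
  by move=> s _ [t ->]; exists (mmul s t); rewrite mmulA.
elim: L {finL} => [|J L [C HC]]; first by exists 0.
have [[x xJ]|noJ] := pselect (exists x, forall z, (exists s, z = mmul s x) <-> J z).
  have [w wx] := gen x; exists (maxn C (size w)) => y J' /= [<-|J'L] yJ.
    exists w; first exact: leq_maxr.
    rewrite wx; split.
      by apply/xJ/yJ; exists (mone M); rewrite mmul1l.
    by apply/yJ/xJ; exists (mone M); rewrite mmul1l.
  by have [v sv] := HC y J' J'L yJ; exists v; rewrite // leq_max sv.
by exists C => y J' /= [<-|] yJ; [case: noJ; exists y|exact: HC yJ].
Qed.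

(** The bounds come before [S], which can thus be chosen later with longer relations as well.
    Induction appends a letter [a] to [p]: once [p] is rewritten as [s w], the word [w a] has length
    at most [C.+1], and a single relation turns it into [s' w']. If [w = t p] and [w' = t' w a] in
    [M], then [w' = t' t p a]. *)
Lemma left_equiv_normal_form : generates g -> finitely_many (@left_ideal M) ->
  exists C K, forall S : seq (seq 'I_n * seq 'I_n),
    (forall l r, size l <= K -> size r <= K -> weval g l = weval g r ->
       List.In (l, r) S) ->
    forall p, exists s w, [/\ thue_cong S p (s ++ w), size w <= C &
      exists t, weval g w = mmul t (weval g p)].
Proof.
move=> gen finL; have [C HC] := left_classes_bounded gen finL.
pose split_bound u k := exists s w, [/\ size (s ++ w) <= k, size w <= C,
  weval g u = weval g (s ++ w) & exists t, weval g w = mmul t (weval g u)].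
have [|u|k Hk] := @uniform_bound_words C.+1 split_bound.
- move=> u k k' le_k [s [w [ss sw e t]]]; exists s, w; split=> //.
  exact: leq_trans le_k.
- have [w sw [[z ez] t]] := HC (weval g u); have [s es] := gen z.
  by exists (size (s ++ w)), s, w; split; rewrite // weval_cat es.
(* The relations used are [u = s ++ w], with [C.+1] bounding the left side and [k] the right
   side. *)
exists C, (maxn k C.+1) => S inS.
have rel u : size u <= C.+1 -> exists s w,
    [/\ thue_cong S u (s ++ w), size w <= C &
      exists t, weval g w = mmul t (weval g u)].
  move=> su; have [s [w [ssw sw e t]]] := Hk u su; exists s, w; split=> //.
  have uS : List.In (u, s ++ w) S.
    by apply: inS; rewrite // leq_max ?ssw ?su ?orbT.
  by have := tc_step [::] [::] uS; rewrite !cats0.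
elim/last_ind=> [|p a [s [w [pS sw [t et]]]]]; first exact: rel.
have [|s' [w' [S' sw' [t' et']]]] := rel (rcons w a); first by rewrite size_rcons.
exists (s ++ s'), w'; split=> //.
  apply: (@tc_trans _ _ _ (s ++ rcons w a)).
    by have := thue_cong_cat [::] [:: a] pS; rewrite /= !cats1 rcons_cat.
  by have := thue_cong_cat s [::] S'; rewrite !cats0 catA.
exists (mmul t' t).
by rewrite et' -!cats1 !weval_cat et !mmulA.
Qed.

Lemma simply_connected_fin_pres : generates g ->
  finitely_many (@left_ideal M) -> coarsely_simply_connected -> fin_pres M.
Proof.
move=> gen finL [K HK].
have [C [K' nf]] := left_equiv_normal_form gen finL.
(* The bound [C + K] admits the relations [w ++ l = w ++ r] that replace a homotopy step. *)
have [S inS] := short_relations_finite (maxn K' (C + K)).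
exists n, g, S; split=> // u v; split; last first.
  elim=> {u v} [p q l r /inS[_ _ e]|//|//|u v w _ -> _ //].
  by rewrite !weval_cat e.
have nfS := nf S; move=> /HK; elim=> {u v} [p l r q sl sr e|u|u v _|u v w _ + _].
- have [|s [w [pS sw [t et]]]] := nfS _ p.
    by move=> l' r' sl' sr' e'; apply/inS; split; rewrite // leq_max ?sl' ?sr'.
  have rewr z : thue_cong S (p ++ z ++ q) (s ++ (w ++ z) ++ q).
    by have := thue_cong_cat [::] (z ++ q) pS; rewrite /= -!catA.
  apply: tc_trans (rewr l) _; apply: tc_trans (tc_sym (rewr r)).
  apply/tc_step/inS; rewrite !size_cat !leq_max !leq_add ?orbT //.
  (* Left multiplication by [t] turns [p l = p r] into [w l = w r]. *)
  split=> //; move: e; rewrite !mmul1l !weval_cat et => e.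
  by rewrite -!mmulA e.
- exact: tc_refl.
- exact: tc_sym.
- exact: tc_trans.
Qed.

End Words.

(** * Images of paths under coarse Lipschitz maps *)

Definition coarse_lipschitz (M N : monoid) (n m : nat) (g : 'I_n -> M)
    (h : 'I_m -> N) (f : M -> N) :=
  exists C, forall x a, reach h C (f x) (f (mmul x (g a))).

Section MapPath.
Variables (M N : monoid) (n m : nat) (g : 'I_n -> M) (h : 'I_m -> N).
Variables (f : M -> N) (e : M -> 'I_n -> seq 'I_m) (C : nat).
Hypothesis size_e : forall x a, size (e x a) <= C.
Hypothesis eval_e : forall x a, mmul (f x) (weval h (e x a)) = f (mmul x (g a)).

Fixpoint map_path (x : M) (u : seq 'I_n) : seq 'I_m :=
  if u is a :: u' then e x a ++ map_path (mmul x (g a)) u' else [::].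

Lemma map_path_cat x u v :
  map_path x (u ++ v) = map_path x u ++ map_path (mmul x (weval g u)) v.
Proof.
elim: u x => [|a u IH] x /=; first by rewrite mmul1r.
by rewrite IH catA mmulA.
Qed.

Lemma map_path_eval x u :
  mmul (f x) (weval h (map_path x u)) = f (mmul x (weval g u)).
Proof.
elim: u x => [|a u IH] x /=; first by rewrite !mmul1r.
by rewrite weval_cat mmulA eval_e IH mmulA.
Qed.

Lemma size_map_path x u : size (map_path x u) <= C * size u.
Proof.
by elim: u x => [|a u IH] x //=; rewrite size_cat mulnS leq_add.
Qed.

(** Since the two subpaths end at the same vertex, their images are parallel and the tail [q] has
    the same image after either. *)
Lemma homot_map_path x K u v :
  homot g x K u v -> homot h (f x) (C * K) (map_path x u) (map_path x v).
Proof.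
elim=> {u v} [p l r q sl sr elr|u|u v _|u v w _ + _].
- have sz y z : size z <= K -> size (map_path y z) <= C * K.
    by move=> sz; rewrite (leq_trans (size_map_path _ _)) // leq_mul2l sz orbT.
  rewrite !map_path_cat -!mmulA -!weval_cat elr.
  apply: homot_step; rewrite ?sz //.
  by rewrite -!map_path_cat !map_path_eval elr.
- exact: homot_refl.
- exact: homot_sym.
- exact: homot_trans.
Qed.

End MapPath.

Lemma coarse_lipschitz_path (M N : monoid) n m (g : 'I_n -> M) (h : 'I_m -> N) f :
  coarse_lipschitz g h f -> exists C (e : M -> 'I_n -> seq 'I_m),
    (forall x a, size (e x a) <= C) /\
    (forall x a, mmul (f x) (weval h (e x a)) = f (mmul x (g a))).
Proof.
case=> C lipC.
have /choice[e He] (xa : M * 'I_n) : exists w, size w <= C /\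
    mmul (f xa.1) (weval h w) = f (mmul xa.1 (g xa.2)).
  by have [w] := lipC xa.1 xa.2; exists w.
by exists C, (fun x a => e (x, a)); split=> x a; case: (He (x, a)).
Qed.

(** * The ladder argument *)

Section Transfer.
Variables (M N : monoid) (n m : nat) (g : 'I_n -> M) (h : 'I_m -> N).

(** Parallel paths in [N] are sent to [M] by [k], joined there by a homotopy, and this homotopy is
    carried back by [f]. A ladder with rungs [d] and [d'] links each path to its image under the
    round trip. *)
Lemma simply_connected_transfer (f : M -> N) (k : N -> M) (D : nat) :
  generates g -> generates h ->
  coarse_lipschitz g h f -> coarse_lipschitz h g k ->
  (forall y, reach h D y (f (k y)) /\ reach h D (f (k y)) y) ->
  coarsely_simply_connected g -> coarsely_simply_connected h.
Proof.
move=> geng genh /coarse_lipschitz_path[C [e [se ee]]].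
move=> /coarse_lipschitz_path[C' [e' [se' ee']]] close [K HK].
have /choice[d Hd] y : exists w, size w <= D /\ mmul y (weval h w) = f (k y).
  by case: (close y) => -[w] + + _; exists w.
have /choice[d' Hd'] y : exists w, size w <= D /\ mmul (f (k y)) (weval h w) = y.
  by case: (close y) => _ [w]; exists w.
pose kp := map_path h e'; pose fp := map_path g e; pose fk y u := fp (k y) (kp y u).
have fk_cat y u v : fk y (u ++ v) = fk y u ++ fk (mmul y (weval h u)) v.
  by rewrite /fk /kp map_path_cat /fp map_path_cat (map_path_eval ee').
have fk_eval y u : mmul (f (k y)) (weval h (fk y u)) = f (k (mmul y (weval h u))).
  by rewrite /fk /fp (map_path_eval ee) (map_path_eval ee').
(* The empty path needs [D + D] for [d y ++ d' y]; the square over one edge has sides of length at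
   most [1 + D] and [D + C * C']. *)
pose B := (D + D + C * C').+1.
have ladder u y :
    homot h y B u (d y ++ fk y u ++ d' (mmul y (weval h u))).
  elim: u y => [|a u IH] y.
    rewrite /= mmul1r; apply: homot_parallel => //.
      by rewrite size_cat leqW // (leq_trans (leq_add (Hd y).1 (Hd' y).1)) ?leq_addr.
    by rewrite weval_cat mmulA (Hd y).2 (Hd' y).2 mmul1r.
  (* The induction hypothesis, applied beyond the first edge, leaves only the square over that edge
     to fill. *)
  have := homot_catl (p := [:: a]) (IH (mmul y (weval h [:: a]))).
  move/homot_trans; apply.
  rewrite -(cat1s a u) fk_cat weval_cat mmulA !catA.
  do 2! apply: homot_catr; set ya := mmul y _.
  apply: homot_parallel.
  - by rewrite size_cat ltnS -addnA (leq_trans (Hd ya).1) ?leq_addr.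
  - have s1 : size (fk y [:: a]) <= C * C'.
      rewrite (leq_trans (size_map_path g se _ _)) // leq_mul2l.
      by rewrite -(muln1 C') (size_map_path h se' y [:: a]) orbT.
    rewrite size_cat leqW // leq_add // (leq_trans (Hd y).1) ?leq_addr //.
  - by rewrite 2!weval_cat [LHS]mmulA [RHS]mmulA -/ya (Hd ya).2 (Hd y).2 fk_eval.
(* In [M] only paths from 1 are known to be homotopic, while images under [k] start at [k 1]. The
   word [gam] joins 1 to [k 1], and [base] joins 1 to [f (k 1)] by way of [f 1]. *)
have [gam egam] := geng (k (mone N)); have [eta eeta] := genh (f (mone M)).
pose base := eta ++ fp (mone M) gam.
have ebase : weval h base = f (k (mone N)).
  by rewrite weval_cat eeta (map_path_eval ee) mmul1l egam.
(* [B] serves the ladder, [size base] and [D] the exchange of the first rung for [base], and [C * K]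
   the image of a homotopy in [M]. *)
pose B' := maxn B (maxn (size base) (maxn D (C * K))).
have [leB lebase leD leCK] : [/\ B <= B', size base <= B', D <= B' & C * K <= B'].
  by rewrite !leq_max !leqnn !orbT.
exists B' => u v euv.
have toBase w : homot h (mone N) B' w
    (base ++ fk (mone N) w ++ d' (weval h w)).
  have := homotW leB (ladder w (mone N)); rewrite mmul1l => /homot_trans; apply.
  apply: homot_catr; apply: homot_parallel => //.
    exact: leq_trans (Hd _).1 leD.
  by rewrite (Hd _).2 mmul1l.
apply: homot_trans (toBase u) _; apply: homot_trans (homot_sym (toBase v)).
(* The last rungs agree because [u] and [v] have the same value, and [eta] is a common prefix; what
   remains is the image of two parallel paths from 1 in [M]. *)
rewrite euv !catA; apply: homot_catr; rewrite /base -!catA.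
apply: homot_catl; rewrite mmul1l eeta; apply: homotW leCK _.
have fk_gam w : fp (mone M) gam ++ fk (mone N) w = fp (mone M) (gam ++ kp (mone N) w).
  by rewrite /fp map_path_cat mmul1l egam.
rewrite !fk_gam; apply: (homot_map_path se ee); apply: HK.
by rewrite !weval_cat egam !(map_path_eval ee') euv.
Qed.

End Transfer.

(** * From quasi-isometries to bounded reachability *)

Lemma reach_change_generators (M : monoid) n n' (g : 'I_n -> M) (g' : 'I_n' -> M) K :
  generates g' -> exists K', forall x y, reach g K x y -> reach g' K' x y.
Proof.
move=> gen'.
have [||K' HK'] := @uniform_bound_words n K
  (fun w k => exists2 v, size v <= k & weval g' v = weval g w).
- by move=> w k k' le_k [v sv e]; exists v; rewrite // (leq_trans sv).
- by move=> w; have [v e] := gen' (weval g w); exists (size v), v.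
by exists K' => x y [w /HK'[v sv <-] <-]; exists v.
Qed.

Section QuasiIsometry.
Import Order.TTheory GRing.Theory Num.Theory.
Local Open Scope ring_scope.

Lemma reach_dA (M : monoid) n (g : 'I_n -> M) K x y :
  reach g K x y -> (dA g x y <= (K%:R)%:E)%E.
Proof.
move=> [w sw exy]; apply: (@le_trans _ _ ((size w)%:R)%:E); last by rewrite lee_fin ler_nat.
by apply: ereal_inf_lbound; exists w.
Qed.

Lemma dA_reach (M : monoid) n (g : 'I_n -> M) (r : R) :
  exists K, forall x y, (dA g x y <= r%:E)%E -> reach g K x y.
Proof.
(* The slack 1 makes the bound on the infimum strict, which yields an actual word. *)
exists (Num.truncn (r + 1)) => x y dxy.
have /ereal_inf_lt[_ [w exy <-]] : (dA g x y < (r + 1)%:E)%E.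
  by apply: le_lt_trans dxy _; rewrite lte_fin ltrDl.
rewrite lte_fin => ltw; exists w => //.
by rewrite -ltnS -(ltr_nat R) (lt_trans ltw) // truncnS_gt.
Qed.

Lemma quasi_isometry_coarse (M N : monoid) n m (g : 'I_n -> M) (h : 'I_m -> N) f :
  quasi_isometry (dA g) (dA h) f ->
  [/\ forall K, exists K', forall x y, reach g K x y -> reach h K' (f x) (f y),
      forall K, exists K', forall x y, reach h K (f x) (f y) -> reach g K' x y
    & exists D, forall y, exists x, reach h D y (f x) /\ reach h D (f x) y].
Proof.
move=> [lam [eps [mu [lam1 eps0 mu0 qi dense]]]].
have lam0 : 0 < lam by apply: lt_le_trans lam1.
split.
- move=> K; have [K' HK'] := dA_reach h (lam * K%:R + eps); exists K' => x y.
  move=> /reach_dA dxy; apply/HK'/(le_trans (qi x y).2).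
  by rewrite EFinD EFinM leeD2r // lee_pmul2l // lte_fin.
- move=> K; have [K' HK'] := dA_reach g (lam * (K%:R + eps)); exists K' => x y.
  move=> /reach_dA dxy; apply: HK'.
  have := le_trans (qi x y).1 dxy.
  by rewrite leeBlDr // lee_pdivrMl // -EFinD -EFinM.
- have [D HD] := dA_reach h mu; exists D => y.
  by have [x [d1 d2]] := dense y; exists x; split; apply: HD.
Qed.

End QuasiIsometry.

(** The generators [g] of the presentation may differ from the generators [g'] of the
    quasi-isometry. Coarse density provides the quasi-inverse [k]. *)
Lemma quasi_isometry_simply_connected (M N : monoid) n n' m
    (g : 'I_n -> M) (g' : 'I_n' -> M) (h : 'I_m -> N) f :
  generates g -> generates g' -> generates h -> quasi_isometry (dA g') (dA h) f ->
  coarsely_simply_connected g -> coarsely_simply_connected h.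
Proof.
move=> geng geng' genh /quasi_isometry_coarse[fwd bwd [D dense]].
have [k Hk] := choice dense.
have edge (L : monoid) i (b : 'I_i -> L) x a : reach b 1 x (mmul x (b a)).
  by exists [:: a]; rewrite ?weval1.
apply: (simply_connected_transfer (f := f) (k := k) (D := D)) => //.
- have [K1 H1] := reach_change_generators g 1 geng'.
  have [K2 H2] := fwd K1; exists K2 => x a; exact/H2/H1/edge.
(* The route goes from [f (k y)] to [y], along one edge, then to the image under [f] and [k] of its
   end; the lower quasi-isometry bound pulls it back to [M]. *)
- have [K1 H1] := bwd (D + 1 + D).
  have [K2 H2] := reach_change_generators g' K1 geng.
  exists K2 => y a; apply/H2/H1.
  apply: reach_trans (Hk _).1; exact: reach_trans (Hk _).2 (edge _ _ _ _ _).
Qed.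

Theorem theorem5p5 (M N : monoid) :
  fin_gen M -> fin_gen N ->
  finitely_many (@left_ideal M) -> finitely_many (@right_ideal M) ->
  finitely_many (@left_ideal N) -> finitely_many (@right_ideal N) ->
  quasi_isometric M N ->
  fin_pres M -> fin_pres N.
Proof.
move=> _ _ _ _ finL _ [n [g' [m [h [geng' [genh [f qi]]]]]]] [k [g [S [geng pres]]]].
apply: (simply_connected_fin_pres genh finL).
apply: (quasi_isometry_simply_connected geng geng' genh qi).
have [|K HK] := @thue_cong_homot _ _ g S; first by move=> u v /pres.
by exists K => u v /pres/HK.
Qed.
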